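(* For any real number $p$ with $1<p\leq\frac{\log(5/2)}{\log 2}$ we have $e(\ell_p^4)\geq 6$.
   Context: For $1<p<\infty$ and an integer $d\geq 1$, $\ell_p^d$ denotes $\mathbb{R}^d$ endowed with the norm $\|x\|_p=\left(\sum_{i=1}^d|x_i|^p\right)^{1/p}$. A set $S\subset \ell_p^d$ is $\lambda$-equilateral ($\lambda>0$) if $\|x-y\|_p=\lambda$ for all distinct $x,y\in S$, and equilateral if it is $\lambda$-equilateral for some $\lambda>0$. The maximum number of elements in an equilateral set in $\ell_p^d$ is denoted by $e(\ell_p^d)$. *)

(* Defs.v *)
From mathcomp Require Import all_boot all_order all_algebra.
From mathcomp Require Import all_classical all_reals all_analysis.

Set Implicit Arguments.
Unset Strict Implicit.
Unset Printing Implicit Defensive.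

Import Order.TTheory GRing.Theory Num.Theory.

Local Open Scope classical_set_scope.
Local Open Scope ring_scope.

Definition lpnorm (R : realType) (p : R) (d : nat) (x : 'rV[R]_d) : R :=
  (\sum_(i < d) `|x ord0 i| `^ p) `^ p^-1.

Definition equilateral_with (R : realType) (p : R) (d : nat) (lambda : R)
    (S : set 'rV[R]_d) : Prop :=
  forall x y : 'rV[R]_d, S x -> S y -> x <> y -> lpnorm p (x - y) = lambda.

Definition equilateral (R : realType) (p : R) (d : nat)
    (S : set 'rV[R]_d) : Prop :=
  exists2 lambda : R, 0 < lambda & equilateral_with p lambda S.

(* [counting S] is the number of elements of S, +oo if S is infinite.  The
   supremum is taken in the extended reals so that it is defined without first
   bounding the size of equilateral sets; it is the maximum whenever one
   exists (equilateral_number_max). *)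
Definition equilateral_number (R : realType) (p : R) (d : nat) : \bar R :=
  ereal_sup [set counting S | S in [set S : set 'rV[R]_d | equilateral p S]].

Lemma equilateral_number_max (R : realType) (p : R) (d : nat)
    (S : set 'rV[R]_d) :
  equilateral p S ->
  (forall T : set 'rV[R]_d, equilateral p T ->
     (counting T <= counting S :> \bar R)%E) ->
  equilateral_number p d = counting S.
Proof.
move=> eS maxS; apply/eqP; rewrite eq_le; apply/andP; split.
  by apply: ge_ereal_sup => _ [T eT <-]; exact: maxS.
by apply: ereal_sup_ubound; exists S.
Qed.

(* Main.v *)
Require Import Defs.
From mathcomp Require Import all_boot all_order all_algebra.
From mathcomp Require Import all_classical all_reals all_analysis.
From mathcomp Require Import ring lra.

Set Implicit Arguments.
Unset Strict Implicit.
Unset Printing Implicit Defensive.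

Import Order.TTheory GRing.Theory Num.Theory.
Import numFieldNormedType.Exports.

Local Open Scope classical_set_scope.
Local Open Scope ring_scope.

(** Six equilateral points are found by combining a tetrahedron of dimension 3
    with a segment in the fourth coordinate. Write y = 2^p, so that
    2 < y <= 5/2, and take
      (1, t, u, 0), (-1, -t, u, 0), (-t, 1, -u, 0), (t, -1, -u, 0),
      (0, 0, 0, h), (0, 0, 0, -h).
    The tetrahedron consists of two opposite edges, at heights u and -u, the
    second being the first turned by a right angle. Its symmetries make the
    origin equidistant from the four vertices and the four remaining edges
    equally long, so only four distances occur. With N = 1 + |t|^p, their p-th
    powers are
      y N           between the ends of one of the two edges,
      y |h|^p       between the last two points,
      N + |u|^p + |h|^p                   from the tetrahedron to the segment,
      |1 + t|^p + |1 - t|^p + y |u|^p     between the two edges.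
    They all equal y N once |h|^p = N, |u|^p = (y - 2) N and
      |1 + t|^p + |1 - t|^p = y (3 - y) N.
    The first two equations determine h and u, since y >= 2. The last one is an
    equation in t alone, solved by the intermediate value theorem on [0, 1]
    ([exists_slope]). At t = 0 its left side is the larger one because
    (y - 1) (y - 2) >= 0; at t = 1, where the tetrahedron is inscribed in a box
    parallel to the axes, the right side is the larger one exactly when
    y <= 5/2, and this is the hypothesis on p. *)

(** Away from 0 the power function is differentiable; at 0 the modulus of
    continuity is explicit, |y| < e^(1/p) giving |y|^p < e. *)
Lemma continuous_norm_powR (R : realType) (p : R) :
  0 < p -> continuous (fun x : R => `|x| `^ p).
Proof.
move=> p0 x; have [->|x0] := eqVneq x 0; last first.
  apply: (@continuous_comp _ _ _ (@Num.norm R R) (fun y => y `^ p)).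
    exact: norm_continuous.
  apply/differentiable_continuous/derivable1_diffP/derivable_powR.
  by rewrite in_itv/= andbT normr_gt0.
apply/cvgrPdist_lt => e e0; rewrite normr0 powR0 ?gt_eqF//.
have d0 : 0 < e `^ p^-1 by exact: powR_gt0.
near=> y; rewrite sub0r normrN ger0_norm ?powR_ge0//.
have -> : e = (e `^ p^-1) `^ p by rewrite -powRrM mulVf ?gt_eqF// powRr1// ltW.
rewrite gt0_ltr_powR ?nnegrE ?powR_ge0//.
Unshelve. all: by end_near. Qed.

(** A family of points at a common nonzero distance is automatically injective,
    so no separate check that the points are distinct is needed; p-th powers of
    distances suffice, and by symmetry only for ordered pairs of indices. *)
Lemma equilateral_family_le (R : realType) (p L : R) (d n : nat)
    (f : 'I_n -> 'rV[R]_d) :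
  0 < p -> 0 < L ->
  (forall i j : 'I_n, (i < j)%N -> \sum_(k < d) `|(f i - f j) ord0 k| `^ p = L) ->
  (n%:R%:E <= equilateral_number p d)%E.
Proof.
move=> p0 L0 fL.
have pf (i j : 'I_n) : i != j -> \sum_(k < d) `|(f i - f j) ord0 k| `^ p = L.
  rewrite neq_ltn => /orP[/fL//|/fL <-].
  by apply: eq_bigr => k _; rewrite -[f i - f j]opprB mxE normrN.
have finj : injective f.
  move=> i j fij; apply/eqP; apply: contraLR L0 => /pf <-.
  rewrite fij subrr big1 ?ltxx// => k _.
  by rewrite mxE normr0 powR0// gt_eqF.
have -> : (n%:R%:E)%E = counting (range f) :> \bar R.
  have fin : finite_set (range f) by exact/finite_image/finite_finset.
  rewrite /counting asboolT//; congr ((_%:R)%:E).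
  apply/esym/card_fset_set/(card_eq_trans (inj_card_eq (in2W finj))).
  by rewrite card_eq_sym card_II.
apply: ereal_sup_ubound; exists (range f) => //.
exists (L `^ p^-1); first exact: powR_gt0.
move=> _ _ [i _ <-] [j _ <-] fij; rewrite /lpnorm pf//.
by apply: contra_not_neq fij => ->.
Qed.

(** The bound y <= 5/2 enters the construction only here, as the sign
    condition at t = 1. *)
Lemma exists_slope (R : realType) (p y : R) : 0 < p -> y = 2 `^ p ->
  2 <= y <= 5 / 2 ->
  exists t : R,
    `|1 + t| `^ p + `|1 - t| `^ p = y * (3 - y) * (1 + `|t| `^ p).
Proof.
move=> p0 yE /andP[y2 y5].
pose g (t : R) := `|1 + t| `^ p + `|1 - t| `^ p - y * (3 - y) * (1 + `|t| `^ p).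
have c := continuous_norm_powR p0.
have cD : continuous (fun t : R => `|1 + t| `^ p).
  move=> t; apply: (@continuous_comp R R R (fun x => 1 + x)
    (fun x => `|x| `^ p)); last exact: c.
  exact: cvgD (cvg_cst _) cvg_id.
have cB : continuous (fun t : R => `|1 - t| `^ p).
  move=> t; apply: (@continuous_comp R R R (fun x => 1 - x)
    (fun x => `|x| `^ p)); last exact: c.
  exact: cvgB (cvg_cst _) cvg_id.
have gc : continuous g.
  move=> t; apply: cvgB; first by apply: cvgD; [exact: cD|exact: cB].
  by apply: cvgM; [exact: cvg_cst|apply: cvgD; [exact: cvg_cst|exact: c]].
have g0 : 0 <= g 0.
  (* g 0 = 2 - y (3 - y) = (y - 1) (y - 2) *)
  by rewrite /g addr0 subr0 normr1 normr0 powR1 powR0 ?gt_eqF//; nra.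
have g1 : g 1 <= 0.
  (* g 1 = y - 2 y (3 - y) = y (2 y - 5) *)
  rewrite /g subrr normr1 normr0 powR1 powR0 ?gt_eqF// -[1 + 1]/(2 : R).
  by rewrite ger0_norm// -yE; nra.
have [||t _ /eqP] := @IVT _ g 0 1 0 ler01.
- exact: continuous_subspaceT.
- by rewrite ge_min le_max g0 g1 orbT.
by rewrite /g subr_eq0 => /eqP tP; exists t.
Qed.

Definition row4 (R : realType) (a b c d : R) : 'rV[R]_4 :=
  \row_(i < 4) nth 0 [:: a; b; c; d] i.

Lemma sum_row4B (R : realType) (p a b c d a' b' c' d' : R) :
  \sum_(k < 4) `|(row4 a b c d - row4 a' b' c' d') ord0 k| `^ p =
  `|a - a'| `^ p + `|b - b'| `^ p + `|c - c'| `^ p + `|d - d'| `^ p.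
Proof. by rewrite !big_ord_recl big_ord0 addr0 !mxE/= !addrA. Qed.

Definition six_points (R : realType) (t u h : R) (i : 'I_6) : 'rV[R]_4 :=
  nth 0 [:: row4 1 t u 0; row4 (-1) (- t) u 0;
            row4 (- t) 1 (- u) 0; row4 t (-1) (- u) 0;
            row4 0 0 0 h; row4 0 0 0 (- h)] i.

(** The three equations are those that make the four distances of the
    configuration agree. *)
Lemma six_points_dist (R : realType) (p t u h y : R) :
  0 < p -> y = 2 `^ p ->
  `|1 + t| `^ p + `|1 - t| `^ p = y * (3 - y) * (1 + `|t| `^ p) ->
  `|u| `^ p = (y - 2) * (1 + `|t| `^ p) -> `|h| `^ p = 1 + `|t| `^ p ->
  forall i j : 'I_6, (i < j)%N ->
  \sum_(k < 4) `|(six_points t u h i - six_points t u h j) ord0 k| `^ p =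
  y * (1 + `|t| `^ p).
Proof.
move=> p0 yE tE uE hE.
have z : `|0 : R| `^ p = 0 by rewrite normr0 powR0 ?gt_eqF.
have o : `|1 : R| `^ p = 1 by rewrite normr1 powR1.
have ev (x : R) : `|- x| `^ p = `|x| `^ p by rewrite normrN.
have db (x : R) : `|x + x| `^ p = y * `|x| `^ p.
  by rewrite -mulr2n -mulr_natl normrM powRM// ger0_norm// yE.
(* The coordinate differences between the two edges are 1 + t and 1 - t up to
   sign; each form in which they arise is reduced to these two. *)
have a1 : `|-1 - t| `^ p = `|1 + t| `^ p by rewrite -ev; congr (`| _ | `^ _); ring.
have a2 : `|-1 + t| `^ p = `|1 - t| `^ p by rewrite -ev; congr (`| _ | `^ _); ring.
have a3 : `|- t - 1| `^ p = `|1 + t| `^ p by rewrite -ev; congr (`| _ | `^ _); ring.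
have a4 : `|t - 1| `^ p = `|1 - t| `^ p by rewrite -ev; congr (`| _ | `^ _); ring.
have a5 : `|- t + 1| `^ p = `|1 - t| `^ p by congr (`| _ | `^ _); ring.
have a6 : `|t + 1| `^ p = `|1 + t| `^ p by congr (`| _ | `^ _); ring.
have simp := (a1, a2, a3, a4, a5, a6).
case=> [[|[|[|[|[|[|//]]]]]] ?] [[|[|[|[|[|[|//]]]]]] ?]// _;
  rewrite /six_points/= sum_row4B;
  rewrite ?(opprK, subr0, sub0r, subrr, add0r) -?opprD
          ?(simp, ev, db, z, o, uE, hE);
  clear -tE; lra.
Qed.

Theorem theorem3 (R : realType) (p : R) (hp1 : 1 < p)
    (hp2 : p <= ln (5 / 2) / ln 2) :
  (6%:R%:E <= equilateral_number p 4)%E.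
Proof.
have p0 : 0 < p by lra.
have [y yE] : exists y, y = 2 `^ p by eexists.
have y2 : 2 <= y by rewrite yE le1r_powR ?ler1n// ltW.
have y5 : y <= 5 / 2.
  rewrite yE -ler_ln ?posrE ?powR_gt0 ?divr_gt0//.
  by rewrite ln_powR -ler_pdivlMr// ln_gt0//; lra.
have [t tE] : exists t : R,
    `|1 + t| `^ p + `|1 - t| `^ p = y * (3 - y) * (1 + `|t| `^ p).
  by apply: exists_slope => //; apply/andP.
pose N := 1 + `|t| `^ p.
have N0 : 0 < N by rewrite ltr_wpDr ?powR_ge0.
have rootK (x : R) : 0 <= x -> `|x `^ p^-1| `^ p = x.
  move=> x0; rewrite ger0_norm ?powR_ge0// -powRrM mulVf ?gt_eqF//.
  by rewrite powRr1.
apply: (@equilateral_family_le _ _ (y * N) _ _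
  (six_points t (((y - 2) * N) `^ p^-1) (N `^ p^-1))) => //.
  by nra.
by apply: (six_points_dist p0 yE) => //; apply: rootK; nra.
Qed.
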